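(* Let $q$ be a prime power with $q \equiv 1 \pmod 4$, let $P_q$ be the Paley graph on $q$ vertices, and let $k \in \mathbb{N}_0$ with $k \leq \frac{\sqrt{q}+3}{2}$. Then $z_k(P_q) = \vartheta(P_q)$.
   Context: Paley graph: for a prime power $q$ with $q \equiv 1 \pmod 4$, $P_q$ is the simple undirected graph whose vertex set $V_q$ is the finite field $\mathbb{F}_q$ (elements labelled $0,\dots,q-1$), two vertices being adjacent iff their difference is a nonzero square in $\mathbb{F}_q$; $E_q$ is its edge set. $\mathbb{N}_0$ denotes the natural numbers including zero. Lovász theta function: for a graph $G=(V,E)$ on $n$ vertices, $$\vartheta(G) = \max\left\{\mathbf{1}_n^T x : \begin{pmatrix} X & x\\ x^T & 1\end{pmatrix}\succeq 0,\ \mathrm{diag}(X)=x,\ X_{ij}=0\ \ \forall \{i,j\}\in E\right\},$$ where $x\in\mathbb{R}^n$, $X\in\mathbb{R}^{n\times n}$ is symmetric, $\mathbf{1}_n$ is the all-ones vector and $\mathrm{diag}(X)$ is the vector of diagonal entries of $X$. Squared stable set polytope: $\mathrm{STAB}^2(G) = \mathrm{conv}\{ss^T : s\in\{0,1\}^n,\ s_is_j=0\ \forall \{i,j\}\in E\}$. For $I\subseteq V$, $G_I$ is the subgraph of $G$ induced by $I$ and $X_I=(X_{ij})_{i,j\in I}$. Exact subgraph hierarchy: for $0 \le k\le n$, $z_k(G)$ is the optimal value of the semidefinite program $$\max\left\{\mathbf{1}_n^T x : \begin{pmatrix} X & x\\ x^T & 1\end{pmatrix}\succeq 0,\ \mathrm{diag}(X)=x,\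 X_{ij}=0\ \ \forall \{i,j\}\in E\right\}$$ with the additional constraints $X_I\in \mathrm{STAB}^2(G_I)$ for all $I\subseteq V$ with $|I|=k$ (for $k=0$ there is no additional constraint, so $z_0(G)=\vartheta(G)$); for $k>n$, $z_k(G)=z_n(G)$. *)

(* Defs.v *)
From mathcomp Require Import all_boot all_order all_algebra all_field.
From mathcomp Require Import boolp classical_sets reals.

Set Implicit Arguments.
Unset Strict Implicit.
Unset Printing Implicit Defensive.

Import Order.TTheory GRing.Theory Num.Theory.
Local Open Scope ring_scope.
Local Open Scope classical_set_scope.

(* A simple undirected graph on n vertices, labelled 0, ..., n-1. *)
Record sgraph (n : nat) := SGraph {
  adj :> rel 'I_n;
  adj_sym : symmetric adj;
  adj_irr : irreflexive adj }.

Definition induced n (G : sgraph n) (I : {set 'I_n}) : sgraph #|I|.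
Proof.
apply: (@SGraph #|I| (fun i j => G (enum_val i) (enum_val j))).
- by move=> i j; exact: adj_sym.
- by move=> i; exact: adj_irr.
Defined.

Definition submatrix (R : Type) n (X : 'M[R]_n) (I : {set 'I_n}) : 'M[R]_#|I| :=
  mxsub (@enum_val _ (mem I)) (@enum_val _ (mem I)) X.

Definition psd (R : realType) n (A : 'M[R]_n) : Prop :=
  A^T = A /\ forall v : 'cV[R]_n, 0 <= (v^T *m A *m v) 0 0.

Definition conv (R : realType) (V : lmodType R) (S : set V) : set V :=
  [set y | exists (m : nat) (w : 'I_m -> R) (z : 'I_m -> V),
     [/\ forall i, 0 <= w i, \sum_i w i = 1, forall i, S (z i)
       & y = \sum_i w i *: z i]].

Definition stable_vector (R : realType) n (G : sgraph n) (s : 'cV[R]_n) : Prop :=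
  (forall i, s i 0 = 0 \/ s i 0 = 1) /\
  (forall i j, G i j -> s i 0 * s j 0 = 0).

Definition STAB2 (R : realType) n (G : sgraph n) : set 'M[R]_n :=
  conv [set Y | exists2 s : 'cV[R]_n, stable_vector G s & Y = s *m s^T].

Definition theta_feasible (R : realType) n (G : sgraph n)
    (X : 'M[R]_n) (x : 'cV[R]_n) : Prop :=
  [/\ psd (block_mx X x x^T 1),
      forall i, X i i = x i 0
    & forall i j, G i j -> X i j = 0].

(* The feasible region is compact and nonempty, so the maximum is the supremum
   of the objective values; esh_values_has_sup below shows that this set is
   nonempty and bounded, so sup never takes its default value. *)
Definition theta (R : realType) n (G : sgraph n) : R :=
  sup [set t | exists (X : 'M[R]_n) (x : 'cV[R]_n),
    theta_feasible G X x /\ t = \sum_i x i 0].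

Definition esh_values (R : realType) n (G : sgraph n) (k : nat) : set R :=
  [set t | exists (X : 'M[R]_n) (x : 'cV[R]_n),
    [/\ theta_feasible G X x,
        forall I : {set 'I_n}, #|I| = k -> STAB2 (induced G I) (submatrix X I)
      & t = \sum_i x i 0]].

(* minn implements the convention z_k = z_n for k > n. For k = 0 the only
   constraint is on an empty matrix and always holds (z0_theta below). *)
Definition esh (R : realType) n (k : nat) (G : sgraph n) : R :=
  sup (esh_values G (minn k n)).

Definition prime_power (q : nat) : Prop :=
  exists p m : nat, [/\ prime p, (0 < m)%N & q = (p ^ m)%N].

Definition nonzero_square (F : finFieldType) (a : F) : bool :=
  (a != 0) && [exists b : F, a == b ^+ 2].

Section Paley.
Variables (F : finFieldType) (q : nat).
Hypotheses (cardF : #|F| = q) (q1mod4 : q = 1 %[mod 4]).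

Lemma opp1_square : exists b : F, b ^+ 2 = -1.
Proof.
have [m Em] : exists m, q = (4 * m).+1.
  exists (q %/ 4)%N.
  by rewrite {1}(divn_eq q 4) q1mod4 addn1 mulnC.
have m_gt0 : (0 < m)%N.
  by have := card_finRing_gt1 F; rewrite cardF Em; case: (m).
have [a a_n0 na1] : exists2 a : F, a != 0 & a ^+ (2 * m) != 1.
  apply: contrapT => noa.
  have : (size (enum [pred a : F | a != 0%R]) <= 2 * m)%N.
    apply: max_unity_roots; rewrite ?enum_uniq ?muln_gt0 //.
    apply/allP => a; rewrite mem_enum inE => a_n0.
    apply/unity_rootP/eqP/negPn/negP => na1.
    by apply: noa; exists a.
  rewrite -cardE.
  have -> : #|[pred a : F | a != 0%R]| = q.-1.
    by rewrite -cardF -(cardC1 (0 : F)); apply: eq_card => a; rewrite !inE.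
  by rewrite Em /= leq_pmul2r.
exists (a ^+ m).
have a4 : a ^+ (4 * m) = 1.
  apply: (mulfI a_n0).
  by rewrite -exprS -Em -cardF expf_card mulr1.
have /eqP : (a ^+ (2 * m)) ^+ 2 = 1 by rewrite -exprM mulnAC -a4.
by rewrite sqrf_eq1 (negPf na1) /= => /eqP <-; rewrite -exprM mulnC.
Qed.

Lemma nonzero_squareN (a : F) : nonzero_square (- a) = nonzero_square a.
Proof.
have [i i2] := opp1_square.
suff H (c : F) : nonzero_square c -> nonzero_square (- c).
  by apply/idP/idP => /H; rewrite ?opprK.
rewrite /nonzero_square => /andP[c_n0 /existsP[b /eqP Eb]].
rewrite oppr_eq0 c_n0 /=.
by apply/existsP; exists (i * b); rewrite exprMn i2 -Eb mulN1r.
Qed.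

(* Vertex i stands for the i-th element of F in the enumeration of F. *)
Definition paley_graph : sgraph #|F|.
Proof.
apply: (@SGraph #|F|
  (fun i j => nonzero_square (enum_val i - enum_val j : F))).
- by move=> i j /=; rewrite -nonzero_squareN opprB.
- by move=> i /=; rewrite /nonzero_square subrr eqxx.
Defined.

End Paley.

Section WellDefined.
Variables (R : realType) (n : nat) (G : sgraph n).

Lemma theta_feasible_le1 (X : 'M[R]_n) (x : 'cV[R]_n) i :
  theta_feasible G X x -> x i 0 <= 1.
Proof.
move=> [[_ P] D _].
have := P (col_mx (delta_mx i 0) (- 1%:M)).
rewrite tr_col_mx mul_row_block mul_row_col !mulmxDl linearN /= trmx1 !mulNmx.
rewrite !mul1mx !mulmxN !mulmx1 trmx_delta -!rowE -!colE !mxE D.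
by rewrite subrr add0r eqxx opprK addrC subr_ge0.
Qed.

Lemma STAB2_0 : STAB2 G (0 : 'M[R]_n).
Proof.
exists 1%N, (fun=> 1), (fun=> 0); split => //.
- by rewrite big_ord1.
- move=> _; exists 0; last by rewrite mul0mx.
  by split => [i|i j _]; rewrite !mxE ?mulr0; first left.
- by rewrite big_ord1 scaler0.
Qed.

End WellDefined.

Lemma esh_values_has_sup (R : realType) n (G : sgraph n) k :
  has_sup (esh_values G k : set R).
Proof.
split.
  exists 0, 0, 0; split; last by rewrite big1 // => i _; rewrite mxE.
  - split => [|i|i j _]; rewrite ?mxE //; split=> [|v].
      by rewrite tr_block_mx !trmx0 trmx1.
    rewrite -[v]vsubmxK trmx0 tr_col_mx mul_row_block mul_row_col.
    rewrite !mulmx0 !add0r mulmx1 mul0mx add0r mxE big_ord1 mxE -expr2.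
    exact: sqr_ge0.
  - move=> I _; have -> : submatrix (0 : 'M[R]_n) I = 0.
      by apply/matrixP => i j; rewrite !mxE.
    exact: STAB2_0.
exists n%:R => _ [X [x [FX _ ->]]].
rewrite -[n in n%:R]card_ord -sum1_card natr_sum.
by apply: ler_sum => i _; exact: theta_feasible_le1 FX.
Qed.

Lemma z0_theta (R : realType) n (G : sgraph n) : esh R 0 G = theta R G.
Proof.
rewrite /esh min0n; congr sup; apply/seteqP; split=> t [X [x]].
  by move=> [FX _ ->]; exists X, x.
move=> [FX ->]; exists X, x; split => // I I0.
have -> : submatrix X I = 0; last exact: STAB2_0.
by apply/matrixP => i; have := ltn_ord i; rewrite {2}I0.
Qed.

(* Main.v *)
(* Write s for the square root of q, Q for the matrix of the quadratic
   character of the differences x - y, and J for the all-ones matrix. Since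
   Q^2 = q - J and QJ = 0, the matrices I + Q/s - J/q and I - Q/s - J/q are twice
   projections, hence positive semidefinite. Pairing the first one with a
   feasible X, on whose support Q is known, bounds theta by s. The second one is
   used to build an optimal X with entries 1/s on the diagonal, 2/(s(s+1)) on
   non-edges and 0 on edges. A principal submatrix of this X of size k is
   diagonally dominant when k <= (s+3)/2, and then it is a convex combination of
   the squares of stable vectors with at most two ones, so that X is feasible
   for the k-th level as well. *)
Require Import Defs.
From mathcomp Require Import all_boot all_order all_algebra all_field.
From mathcomp Require Import boolp classical_sets reals.
From mathcomp Require Import ring lra.

Set Implicit Arguments.
Unset Strict Implicit.
Unset Printing Implicit Defensive.

Import Order.TTheory GRing.Theory Num.Theory.
Local Open Scope ring_scope.

(** * The quadratic character of a finite field of odd order *)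

Definition quad_char (R : realType) (F : finFieldType) (a : F) : R :=
  if a == 0 then 0 else if nonzero_square a then 1 else -1.

Arguments quad_char R {F} a.

Section QuadraticCharacter.
Context (R : realType) (F : finFieldType) (oddF : odd #|F|).
Implicit Types (a b c d x y : F).
Local Notation chi := (@quad_char R F).

(** Translation by 1 permutes [F], so comparing the sum of all elements with its translate gives
    [#|F|%:R = 0] in [F]. If 2 vanished too, oddness would force 1 = 0. *)
Lemma two_neq0 : (1 + 1 : F) != 0.
Proof.
apply: contraTneq oddF => two0.
have natF0 : (#|F|%:R : F) = 0.
  have /eqP := reindex_inj (addrI (1 : F)) : \sum_(x : F) x = _.
  rewrite big_split /= sumr_const -subr_eq0 opprD addrCA subrr addr0 oppr_eq0.
  by move/eqP.
apply: contraPN natF0 => oddF'; rewrite -(odd_double_half #|F|) oddF'.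
rewrite natrD -muln2 natrM [2%:R](_ : _ = 0) ?mulr0 ?addr0; last exact: two0.
by apply/eqP; rewrite oner_eq0.
Qed.

Lemma quad_char0 : chi 0 = 0.
Proof. by rewrite /quad_char eqxx. Qed.

Lemma quad_char_sq b : b != 0 -> chi (b ^+ 2) = 1.
Proof.
move=> b0; rewrite /quad_char /nonzero_square expf_eq0 /= (negPf b0) /=.
by case: existsP => // -[]; exists b.
Qed.

Lemma quad_char1 : chi 1 = 1.
Proof. by rewrite -(expr1n _ 2) quad_char_sq ?oner_eq0. Qed.

Lemma quad_charP a :
  [\/ a = 0, (exists2 b, b != 0 & a = b ^+ 2) | a != 0 /\ chi a = -1].
Proof.
have [->|a0] := eqVneq a 0; first by constructor 1.
rewrite /quad_char (negPf a0) /nonzero_square a0 /=.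
case: existsP => [[b /eqP Eb]|_]; last by constructor 3.
constructor 2; exists b => //.
by apply: contraNneq a0 => b0; rewrite Eb b0 expr0n.
Qed.

Lemma card_sqrt a : 1 + chi a = \sum_(b | b ^+ 2 == a) 1.
Proof.
have [->|[c c0 ->]|[a0 Ea]] := quad_charP a.
- rewrite quad_char0 addr0 (bigD1 0) /= ?expr0n //= big1 ?addr0 // => b.
  by rewrite expf_eq0 /= => /andP[/eqP->]; rewrite eqxx.
- rewrite quad_char_sq // (bigD1 c) //= (bigD1 (- c)) /=; last first.
    rewrite sqrrN eqxx /= eq_sym -subr_eq0 opprK -mulr2n -mulr_natr.
    by rewrite mulf_neq0 // two_neq0.
  rewrite big1 ?addr0 // => b; rewrite eqf_sqr -andbA.
  by case/and3P=> /orP[->|->] //; rewrite andbF.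
- rewrite Ea subrr big1 // => b /eqP Eb; move: Ea.
  rewrite -Eb quad_char_sq; first by move=> ?; lra.
  by apply: contraNneq a0 => b0; rewrite -Eb b0 expr0n.
Qed.

(** By [card_sqrt], summing [1 + chi a] counts every b once, as a root of its own square; the total
    is therefore [#|F|]. *)
Lemma sum_quad_char : \sum_a chi a = 0.
Proof.
have: \sum_a (1 + chi a) = \sum_(b : F) (1 : R).
  under eq_bigr do rewrite card_sqrt.
  rewrite (exchange_big_dep xpredT) //=; apply: eq_bigr => b _.
  by under eq_bigl do rewrite eq_sym; rewrite big_pred1_eq.
by rewrite big_split /= => /eqP; rewrite addrC -subr_eq0 addrK => /eqP.
Qed.

Lemma quad_charM_sq b a : b != 0 -> chi (b ^+ 2 * a) = chi a.
Proof.
move=> b0; have [->|[c c0 ->]|[a0 Ea]] := quad_charP a.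
- by rewrite mulr0.
- by rewrite -exprMn !quad_char_sq ?mulf_neq0.
rewrite Ea; have [/eqP|[c c0 Ec]|[]//] := quad_charP (b ^+ 2 * a).
  by rewrite mulf_eq0 expf_eq0 /= (negPf b0) (negPf a0).
have Ea' : a = (c / b) ^+ 2 by rewrite expr_div_n -Ec mulrC mulKf ?expf_neq0.
by move: Ea; rewrite Ea' quad_char_sq ?mulf_neq0 ?invr_eq0 // => ?; lra.
Qed.

(** That the product of two nonsquares is a square follows by balance: both [chi] and its composite
    with multiplication by a nonsquare sum to 0. *)
Lemma quad_charM a b : chi (a * b) = chi a * chi b.
Proof.
have [->|[c c0 ->]|[a0 Ea]] := quad_charP a.
- by rewrite mul0r quad_char0 mul0r.
- by rewrite quad_charM_sq ?quad_char_sq ?mul1r.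
(* The terms below are nonpositive and their sum vanishes. *)
have le0 y : chi (a * y) + chi y <= 0.
  have [->|[c c0 ->]|[y0 ->]] := quad_charP y.
  - by rewrite mulr0 quad_char0 addr0.
  - by rewrite mulrC quad_charM_sq // quad_char_sq // Ea addNr.
  - by rewrite /quad_char mulf_eq0 (negPf a0) (negPf y0); case: ifP => _; lra.
have sum0 : \sum_y - (chi (a * y) + chi y) = 0.
  rewrite sumrN big_split /= sum_quad_char addr0.
  by have <- := reindex_inj (mulfI a0) : \sum_y chi y = _; rewrite sum_quad_char oppr0.
have /eqP := sum0; rewrite psumr_eq0 => [/allP/(_ b)|y _]; last first.
  by rewrite oppr_ge0.
by rewrite mem_index_enum Ea oppr_eq0 addr_eq0 mulN1r => /(_ isT)/eqP.
Qed.

Lemma quad_char_sqr a : chi a ^+ 2 = (a != 0)%:R.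
Proof.
rewrite /quad_char; case: eqP => _; first by rewrite expr0n.
by case: ifP; rewrite ?sqrrN expr1n.
Qed.

Lemma sum_quad_char_shift d : d != 0 -> \sum_y chi y * chi (y + d) = -1.
Proof.
(* For y != 0, chi (y * (y + d)) = chi (1 + d / y). Since 0^-1 = 0, the map
   y |-> 1 + d / y is a bijection of F, which sends 0 to 1. *)
move=> d0; have injd : injective (fun y : F => 1 + d * y^-1).
  by move=> x y /addrI/(mulfI d0)/invr_inj.
have := reindex_inj injd : \sum_y chi y = _; rewrite sum_quad_char.
rewrite (bigD1 0) //= invr0 mulr0 addr0 quad_char1 => /eqP.
rewrite eq_sym addrC addr_eq0 => /eqP <-.
rewrite (bigD1 0) //= quad_char0 mul0r add0r; apply: eq_bigr => y y0.
rewrite -quad_charM (_ : y * (y + d) = y ^+ 2 * (1 + d * y^-1)).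
  by rewrite quad_charM_sq.
by field.
Qed.

End QuadraticCharacter.

(** * Positive semidefinite matrices *)

Section PSD.
Context (R : realType) (n : nat).
Implicit Types (X M : 'M[R]_n) (x : 'cV[R]_n).

Lemma psd_sqr M : M^T = M -> psd (M *m M).
Proof.
move=> symM; split => [|v]; first by rewrite trmx_mul symM.
rewrite mulmxA -mulmxA -{1}symM -trmx_mul mxE.
by apply: sumr_ge0 => i _; rewrite mxE -expr2 sqr_ge0.
Qed.

Lemma psd_scale (a : R) M : 0 <= a -> psd M -> psd (a *: M).
Proof.
move=> a0 [symM posM]; split => [|v]; first by rewrite linearZ /= symM.
by rewrite -scalemxAr -scalemxAl mxE mulr_ge0.
Qed.

(** Completing the square: the form of the block matrix at (u, t) is that of the Schur complement at
    u plus the square of [x^T *m u + t]. *)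
Lemma psd_schur X x : psd (X - x *m x^T) -> psd (block_mx X x x^T 1).
Proof.
move=> [sym pos].
have symX : X^T = X.
  by move: sym; rewrite linearB /= trmx_mul trmxK => /addIr.
split => [|v]; first by rewrite tr_block_mx trmxK trmx1 symX.
rewrite -[v]vsubmxK; set u := usubmx v; set t := dsubmx v.
rewrite tr_col_mx mul_row_block mul_row_col mulmx1.
have -> : (u^T *m X + t^T *m x^T) *m u + (u^T *m x + t^T) *m t
  = u^T *m (X - x *m x^T) *m u + (u^T *m x + t^T) *m (x^T *m u + t).
  rewrite mulmxBr !mulmxDl !mulmxDr mulNmx !mulmxA.
  by rewrite -!addrA addKr [u^T *m x *m t + _ in RHS]addrCA.
have -> : u^T *m x + t^T = (x^T *m u + t)^T.
  by rewrite [RHS]linearD /= trmx_mul trmxK.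
rewrite mxE addr_ge0 ?pos //.
by rewrite mxE big_ord1 mxE -expr2 sqr_ge0.
Qed.

Lemma psd_block_quad X x (v : 'cV[R]_n) (t : R) : psd (block_mx X x x^T 1) ->
  0 <= (v^T *m X *m v) 0 0 + t * (x^T *m v) 0 0 *+ 2 + t ^+ 2.
Proof.
move=> [_ /(_ (col_mx v t%:M))].
rewrite tr_col_mx mul_row_block mul_row_col tr_scalar_mx mulmx1 mul_mx_scalar.
rewrite mul_scalar_mx mulmxDl -scalemxAl !mxE eqxx mulr1n.
have -> : \sum_j v^T 0 j * x j 0 = \sum_j x^T 0 j * v j 0.
  by apply: eq_bigr => j _; rewrite !mxE mulrC.
by move=> H; apply: le_trans H _; rewrite le_eqVlt; apply/orP; left; apply/eqP; ring.
Qed.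

(** By cyclicity this is the trace of M X M, whose diagonal entries are the values of the form of X
    at the columns of M. *)
Lemma mxtrace_mul_sqr_ge0 X x M :
  psd (block_mx X x x^T 1) -> M^T = M -> 0 <= \tr (X *m (M *m M)).
Proof.
move=> psdX symM; rewrite mulmxA mxtrace_mulC mulmxA.
apply: sumr_ge0 => i _; have := psd_block_quad (col i M) 0 psdX.
rewrite mul0r mul0rn addr0 expr0n addr0 /= tr_col symM.
by rewrite -row_mul colE mulmxA -colE -row_mul !mxE.
Qed.
End PSD.

(** * Diagonally dominant matrices in the squared stable set polytope *)

Section DiagonallyDominant.
Context (R : realType) (n : nat) (G : sgraph n).

(** The missing weight goes to the zero vector, the indicator of the empty stable set, indexed by
    [None]. *)
Lemma STAB2_subconvex (T : finType) (w : T -> R) (s : T -> 'cV[R]_n) :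
  (forall t, 0 <= w t) -> \sum_t w t <= 1 ->
  (forall t, stable_vector G (s t)) ->
  STAB2 G (\sum_t w t *: (s t *m (s t)^T)).
Proof.
move=> w0 w1 stab; pose o := 1 - \sum_t w t.
pose w' (t : option T) := if t is Some t then w t else o.
pose s' (t : option T) := if t is Some t then s t else 0.
exists #|{: option T}|, (fun i => w' (enum_val i)),
  (fun i => s' (enum_val i) *m (s' (enum_val i))^T).
have sumE (V : nmodType) (f : option T -> V) :
    \sum_(i < #|{: option T}|) f (enum_val i) = f None + \sum_t f (Some t).
  rewrite -(reindex enum_val (onW_bij predT (enum_val_bij _)) : \sum_t f t = _).
  rewrite (bigD1 None) //=; congr (_ + _).
  rewrite (reindex_omap Some id) /=; last by case.
  by apply: eq_bigl => t; rewrite eqxx.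
split.
- by move=> i; case: (enum_val i) => [t|] /=; rewrite /o ?subr_ge0.
- by rewrite (sumE _ w') /= subrK.
- move=> i; exists (s' (enum_val i)) => //; case: (enum_val i) => [t|] //=.
  by split => [j|j l _]; rewrite !mxE ?mulr0; first left.
- rewrite (sumE _ (fun t => w' t *: (s' t *m (s' t)^T))) /=.
  by rewrite mul0mx scaler0 add0r.
Qed.

Lemma stable_vector_delta i : stable_vector G (delta_mx i 0 : 'cV[R]_n).
Proof.
split => [j|j l Gjl]; rewrite !mxE !eqxx !andbT.
  by case: (j == i); [right|left].
case: eqVneq Gjl => [->|_ _]; last by rewrite mul0r.
by case: eqVneq => [->|_ _]; rewrite ?adj_irr ?mulr0.
Qed.

Lemma stable_vector_pair i j : i != j -> ~~ G i j ->
  stable_vector G (delta_mx i 0 + delta_mx j 0 : 'cV[R]_n).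
Proof.
move=> nij nGij; have nGji : ~~ G j i by rewrite adj_sym.
split => [k|k l Gkl]; rewrite !mxE !eqxx !andbT.
  have [->|_] := eqVneq k i; first by right; rewrite (negPf nij) addr0.
  by rewrite add0r; case: (k == j); [right|left].
have [|/norP[/negPf-> /negPf->]] := boolP ((k == i) || (k == j)); last first.
  by rewrite addr0 mul0r.
have [|/norP[/negPf-> /negPf->]] := boolP ((l == i) || (l == j)); last first.
  by rewrite addr0 mulr0.
move=> /orP[] /eqP Ek /orP[] /eqP El; move: Gkl;
  by rewrite Ek El ?adj_irr ?(negPf nGij) ?(negPf nGji).
Qed.

Lemma delta_mx_outer i j :
  (delta_mx i 0 : 'cV[R]_n) *m (delta_mx j 0 : 'cV_n)^T = delta_mx i j.
Proof. by rewrite trmx_delta mul_delta_mx. Qed.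

(* Singletons and non-adjacent pairs already suffice as stable sets: the pairs
   account for the off-diagonal entries and the singletons for the slack on the
   diagonal. *)
Lemma STAB2_diag_dominant (Y : 'M[R]_n) :
  Y^T = Y -> (forall i j, 0 <= Y i j) -> (forall i j, G i j -> Y i j = 0) ->
  (forall i, \sum_(j | j != i) Y i j <= Y i i) -> \tr Y <= 1 -> STAB2 G Y.
Proof.
move=> symY Y0 YG domY trY.
pose u i j := if j != i then Y i j else 0.
have uC i j : u i j = u j i by rewrite /u eq_sym -{1}symY mxE.
have u0 i j : 0 <= u i j by rewrite /u; case: ifP.
pose d i := \sum_j u i j.
have dE i : d i = \sum_(j | j != i) Y i j by rewrite [RHS]big_mkcond.
pose e i : 'cV[R]_n := delta_mx i 0.
(* Pairs are ordered, so each unordered pair occurs twice and gets half the weight each time. Equal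
   or adjacent pairs have weight 0; [s] sends them to the zero vector only to stay stable. *)
pose w (t : 'I_n + 'I_n * 'I_n) :=
  match t with inl i => Y i i - d i | inr ij => u ij.1 ij.2 / 2 end.
pose s (t : 'I_n + 'I_n * 'I_n) := match t with
  | inl i => e i
  | inr ij => if (ij.1 != ij.2) && ~~ G ij.1 ij.2 then e ij.1 + e ij.2 else 0
  end.
have half (f g : 'I_n -> 'I_n -> 'M[R]_n) : (forall i j, g i j = f j i) ->
    \sum_i \sum_j (u i j / 2) *: (f i j + g i j)
    = \sum_i \sum_j u i j *: f i j.
  move=> gf; under eq_bigr do under eq_bigr do rewrite scalerDr gf.
  under eq_bigr do rewrite big_split /=.
  rewrite big_split /= [X in _ + X]exchange_big /= -big_split /=.
  apply: eq_bigr => i _; rewrite -big_split /=; apply: eq_bigr => j _.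
  by rewrite [u j i]uC -scalerDl -splitr.
(* The four terms of the outer square of [e i + e j] are grouped into a diagonal and an off-diagonal
   part, each of which [half] then simplifies. *)
have pairs : \sum_ij (u ij.1 ij.2 / 2) *: (s (inr ij) *m (s (inr ij))^T)
    = \sum_i \sum_j (u i j / 2) *: (delta_mx i i + delta_mx j j)
      + \sum_i \sum_j (u i j / 2) *: (delta_mx i j + delta_mx j i).
  rewrite !pair_bigA -big_split /=; apply: eq_bigr => -[i j] _ /=.
  rewrite -scalerDr; case: ifP => [_|].
    rewrite linearD /= mulmxDl !mulmxDr !delta_mx_outer.
    by congr (_ *: _); rewrite [delta_mx j i + _]addrC addrACA.
  rewrite mul0mx scaler0 => /negbT; rewrite negb_and !negbK /u.
  case: eqVneq => [_|_ /=]; first by rewrite mul0r scale0r.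
  by move/YG->; rewrite mul0r scale0r.
have Yws : Y = \sum_t w t *: (s t *m (s t)^T).
  rewrite big_sumType /= pairs.
  rewrite (half (fun i j => delta_mx i i)) // (half (fun i j => delta_mx i j)) //.
  under [X in _ + (X + _)]eq_bigr do rewrite -scaler_suml -/(d _).
  under eq_bigr do rewrite delta_mx_outer scalerBl.
  rewrite sumrB addrA subrK {1}[Y]matrix_sum_delta -big_split /=.
  apply: eq_bigr => i _; rewrite (bigD1 i) //=; congr (_ + _).
  rewrite big_mkcond; apply: eq_bigr => j _; rewrite /u.
  by case: ifP => // _; rewrite scale0r.
rewrite Yws; apply: STAB2_subconvex.
- by case=> [i|[i j]] /=; [rewrite subr_ge0 dE|rewrite divr_ge0].
(* With D the sum of the [d i], the total weight is tr Y - D + D/2. *)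
- rewrite big_sumType /= sumrB; apply: le_trans trY.
  rewrite -(pair_bigA _ (fun i j => u i j / 2)) /=.
  have -> : \sum_i \sum_j u i j / 2 = (\sum_i d i) / 2.
    by rewrite mulr_suml; apply: eq_bigr => i _; rewrite -mulr_suml.
  rewrite /mxtrace -addrA gerDl addrC subr_le0 ler_pdivrMr //.
  by rewrite ler_peMr ?ler1n // sumr_ge0 // => i _; apply: sumr_ge0.
- case=> [i|[i j]] /=; first exact: stable_vector_delta.
  case: ifP => [/andP[]|_]; first exact: stable_vector_pair.
  by split => [k|k l _]; rewrite !mxE ?mulr0; first left.
Qed.
End DiagonallyDominant.

(** * The matrix of the Paley graph, the bound on theta and the optimal solution *)

Section PaleyMatrices.
Context (R : realType) (q : nat) (F : finFieldType).
Context (hF : #|F| = q) (hq4 : q = 1 %[mod 4]).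
Local Notation n := #|F|.
Local Notation G := (paley_graph hF hq4).
Local Notation J := (const_mx 1 : 'M[R]_n).
Local Notation s := (Num.sqrt n%:R : R).
Implicit Types (i j : 'I_n) (e : R).

Lemma paley_odd : odd n.
Proof.
by rewrite hF (divn_eq q 4) hq4 addn1 /= oddM andbF.
Qed.

Lemma sqr_sqrt_order : s ^+ 2 = n%:R.
Proof. by rewrite sqr_sqrtr ?ler0n. Qed.

Lemma sqrt_order_gt2 : 2 < s.
Proof.
have n5 : (4 < n)%N.
  rewrite hF (divn_eq q 4) hq4 addn1 ltnS.
  have := card_finNzRing_gt1 F; rewrite hF {1}(divn_eq q 4) hq4 addn1 ltnS.
  by rewrite muln_gt0 => /andP[q4 _]; rewrite leq_pmull.
have : (4 : R) < s ^+ 2 by rewrite sqr_sqrt_order ltr_nat.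
by have := sqrtr_ge0 (n%:R : R); nra.
Qed.

Definition paley_mx : 'M[R]_n :=
  \matrix_(i, j) quad_char R (enum_val i - enum_val j : F).
Local Notation Q := paley_mx.

Lemma sum_enum_val (f : F -> R) : \sum_(i < n) f (enum_val i) = \sum_x f x.
Proof.
by rewrite -(reindex enum_val (onW_bij predT (enum_val_bij _)) : \sum_x f x = _).
Qed.

Lemma paley_mx_sym : Q^T = Q.
Proof.
apply/matrixP => i j; rewrite !mxE -opprB /quad_char oppr_eq0.
by rewrite (nonzero_squareN hF hq4).
Qed.

Lemma paley_mx_diag i : Q i i = 0.
Proof. by rewrite mxE subrr quad_char0. Qed.

Lemma paley_mx_adj i j : G i j -> Q i j = 1.
Proof.
move=> Gij; have Gij' : nonzero_square (enum_val i - enum_val j : F) by [].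
by rewrite mxE /quad_char Gij'; case/andP: Gij' => /negPf->.
Qed.

Lemma paley_mx_nonadj i j : i != j -> ~~ G i j -> Q i j = -1.
Proof.
move=> nij Gij; have Gij' : ~~ nonzero_square (enum_val i - enum_val j : F) by [].
by rewrite mxE /quad_char (negPf Gij') subr_eq0 (inj_eq enum_val_inj) (negPf nij).
Qed.

Lemma mul_ones_paley_mx : J *m Q = 0.
Proof.
apply/matrixP => i j; rewrite !mxE -[RHS](sum_quad_char R paley_odd).
under eq_bigr do rewrite !mxE mul1r.
rewrite (sum_enum_val (fun x => quad_char R (x - enum_val j))).
by rewrite [RHS](reindex_inj (addIr (- enum_val j))).
Qed.

Lemma mul_paley_mx_ones : Q *m J = 0.
Proof.
by rewrite -[LHS]trmxK trmx_mul trmx_const paley_mx_sym mul_ones_paley_mx trmx0.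
Qed.

Lemma mul_ones : J *m J = n%:R *: J.
Proof.
apply/matrixP => i j; rewrite !mxE mulr1; under eq_bigr do rewrite !mxE mulr1.
by rewrite sumr_const card_ord.
Qed.

(** After a shift, entry (i, j) is the sum of [chi y * chi (y + d)] with d the difference of the two
    vertices: -1 if d is nonzero, and q - 1 on the diagonal. *)
Lemma paley_mx_sqr : Q *m Q = n%:R%:M - J.
Proof.
apply/matrixP => i j; rewrite -{1}paley_mx_sym !mxE.
under eq_bigr do rewrite !mxE.
rewrite (sum_enum_val (fun x => quad_char R (x - enum_val i) *
  quad_char R (x - enum_val j))).
rewrite (reindex_inj (addIr (enum_val i))) /=.
under eq_bigr do rewrite addrK -addrA.
have [->|nij] := eqVneq i j; last first.
  rewrite sum_quad_char_shift ?paley_odd ?add0r //.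
  by rewrite subr_eq0 (inj_eq enum_val_inj).
rewrite subrr mulr1n; under eq_bigr do rewrite addr0 -expr2 quad_char_sqr.
rewrite (bigD1 0) //= eqxx add0r.
rewrite (eq_bigr (fun=> 1)) => [|x ->//].
rewrite -[n in RHS]sum1_card natr_sum [in RHS](bigD1 0) //= mulr1n addrC.
by rewrite addKr; apply: eq_bigl.
Qed.

(* Up to the factor 2, the orthogonal projection onto the e * s eigenspace
   of Q. *)
Definition paley_proj e : 'M[R]_n := 1%:M + (e / s) *: Q - n%:R^-1 *: J.

Lemma paley_proj_sym e : (paley_proj e)^T = paley_proj e.
Proof.
by rewrite /paley_proj linearB linearD !linearZ /= trmx1 trmx_const paley_mx_sym.
Qed.

Lemma paley_proj_sqr e : e ^+ 2 = 1 ->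
  paley_proj e *m paley_proj e = 2 *: paley_proj e.
Proof.
move=> e1; have s2 := sqrt_order_gt2; have ns := sqr_sqrt_order.
rewrite /paley_proj; move: s ns s2 => r ns r2.
rewrite mulmxBr mulmxDr mulmx1 -!scalemxAr !mulmxBl !mulmxDl.
rewrite !mul1mx -!scalemxAl paley_mx_sqr mul_ones_paley_mx mul_paley_mx_ones.
rewrite mul_ones -ns; apply/matrixP => i j; rewrite !mxE.
move: (quad_char R _) (i == j) => c b; rewrite -[r ^+ 2 *+ b]mulr_natr.
have rn0 : r != 0 by rewrite gt_eqF //; lra.
(* This form isolates [e ^+ 2], so that it can be replaced by 1. *)
transitivity (b%:R + 2 * (e / r * c) + e ^+ 2 * (b%:R - r ^- 2) - r ^- 2).
  by field.
by rewrite e1; field.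
Qed.

Lemma paley_proj_psd e : e ^+ 2 = 1 -> psd (paley_proj e).
Proof.
move=> e1; have -> : paley_proj e = 2^-1 *: (paley_proj e *m paley_proj e).
  by rewrite paley_proj_sqr // scalerA mulVf ?scale1r ?pnatr_eq0.
by apply: psd_scale; [rewrite invr_ge0 | exact/psd_sqr/paley_proj_sym].
Qed.

(** With t the trace of X and S the sum of its entries, the proof shows [t ^+ 2 <= S <= s * t]. Off
    the diagonal, X vanishes wherever Q is 1, so tr(XQ) = t - S. *)
Lemma theta_feasible_le_sqrt (X : 'M[R]_n) (x : 'cV[R]_n) :
  theta_feasible G X x -> \sum_i x i 0 <= s.
Proof.
move=> [psdX diagX edgeX]; set t := \sum_i x i 0.
have s2 := sqrt_order_gt2.
have trX : \tr X = t by apply: eq_bigr => i _; exact: diagX.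
pose S := \tr (X *m J).
have SE : S = \sum_i \sum_j X i j.
  by apply: eq_bigr => i _; rewrite mxE; apply: eq_bigr => j _; rewrite mxE mulr1.
have trXQ : \tr (X *m Q) = t - S.
  rewrite -trX SE -sumrB; apply: eq_bigr => i _.
  rewrite mxE (bigD1 i) //= [X in _ = _ - X](bigD1 i) //= opprD addrA subrr.
  rewrite paley_mx_diag mulr0 -sumrN; congr (_ + _); apply: eq_bigr => j ji.
  rewrite -{1}paley_mx_sym mxE; have [Gij|nGij] := boolP (G i j).
    by rewrite edgeX // mul0r oppr0.
  by rewrite paley_mx_nonadj 1?eq_sym // mulrN1.
have : 0 <= \tr (X *m (paley_proj 1 *m paley_proj 1)).
  exact: mxtrace_mul_sqr_ge0 psdX (paley_proj_sym _).
rewrite paley_proj_sqr ?expr1n // -scalemxAr mxtraceZ pmulr_rge0 //.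
rewrite /paley_proj mulmxBr mulmxDr mulmx1 -!scalemxAr linearB linearD !linearZ /=.
rewrite trX trXQ -/S; have := sqr_sqrt_order.
move: s s2 => r r2 <- traceN.
(* The test vector (1, ..., 1, -t) gives S - 2t^2 + t^2 >= 0. *)
have := psd_block_quad (const_mx 1) (- t) psdX.
have -> : (x^T *m (const_mx 1 : 'cV_n)) 0 0 = t.
  by rewrite mxE; apply: eq_bigr => i _; rewrite !mxE mulr1.
have -> : ((const_mx 1 : 'cV_n)^T *m X *m (const_mx 1 : 'cV_n)) 0 0 = S.
  rewrite SE exchange_big mxE; apply: eq_bigr => j _; rewrite !mxE mulr1.
  by apply: eq_bigr => i _; rewrite !mxE mul1r.
move=> quad; have tS : t ^+ 2 <= S by nra.
(* The paired trace is (r + 1)/r^2 times r t - S; the multiplier undoes this factor. *)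
have sS : S <= r * t.
  have : 0 <= r ^+ 2 / (r + 1) * (t + 1 / r * (t - S) - (r ^+ 2)^-1 * S).
    by rewrite mulr_ge0 // divr_ge0 ?sqr_ge0 //; lra.
  rewrite (_ : _ * _ = r * t - S) ?subr_ge0 //; field.
  by rewrite !gt_eqF //; lra.
by nra.
Qed.

(** The term J/n is the outer square of the constant vector 1/s, so the first term is the Schur
    complement. Its coefficient is the one that makes the entries on edges vanish. *)
Definition paley_opt : 'M[R]_n :=
  (s + 1)^-1 *: paley_proj (-1) + n%:R^-1 *: J.

Lemma paley_opt_diag i : paley_opt i i = s^-1.
Proof.
rewrite !mxE eqxx subrr quad_char0 /=.
move: s sqr_sqrt_order sqrt_order_gt2 => r <- r2.
by field; rewrite !gt_eqF //; lra.
Qed.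

Lemma paley_opt_adj i j : G i j -> paley_opt i j = 0.
Proof.
move=> Gij.
have /negPf ij : i != j by apply: contraTneq Gij => ->; rewrite adj_irr.
have := paley_mx_adj Gij; rewrite !mxE ij => -> /=.
move: s sqr_sqrt_order sqrt_order_gt2 => r <- r2.
by field; rewrite !gt_eqF //; lra.
Qed.

Lemma paley_opt_nonadj i j : i != j -> ~~ G i j ->
  paley_opt i j = 2 / (s * (s + 1)).
Proof.
move=> nij Gij.
have := paley_mx_nonadj nij Gij; rewrite !mxE (negPf nij) => -> /=.
move: s sqr_sqrt_order sqrt_order_gt2 => r <- r2.
by field; rewrite !gt_eqF //; lra.
Qed.

Lemma paley_opt_sym : paley_opt^T = paley_opt.
Proof. by rewrite /paley_opt linearD !linearZ /= trmx_const paley_proj_sym. Qed.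

Lemma paley_opt_feasible : theta_feasible G paley_opt (const_mx s^-1).
Proof.
have s2 := sqrt_order_gt2.
split; [|by move=> i; rewrite paley_opt_diag mxE|exact: paley_opt_adj].
apply: psd_schur.
have -> : (const_mx s^-1 : 'cV[R]_n) *m (const_mx s^-1)^T = n%:R^-1 *: J.
  apply/matrixP => i j.
  by rewrite !mxE big_ord1 !mxE mulr1 -expr2 exprVn sqr_sqrt_order.
rewrite /paley_opt addrK; apply: psd_scale; first by rewrite invr_ge0; lra.
by apply: paley_proj_psd; rewrite sqrrN expr1n.
Qed.

(** A row has |I| - 1 off-diagonal entries, each at most 2/(s(s+1)). Their sum is at most the
    diagonal 1/s as soon as |I| - 1 <= (s+1)/2, which is the hypothesis. *)
Lemma paley_opt_STAB2 (I : {set 'I_n}) : #|I|%:R <= (s + 3) / 2 ->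
  STAB2 (induced G I) (submatrix paley_opt I).
Proof.
move=> cardI; have s2 := sqrt_order_gt2.
have c0 : 0 <= 2 / (s * (s + 1)) :> R by rewrite divr_ge0 ?mulr_ge0 //; lra.
have offdiag i j : i != j -> 0 <= paley_opt i j <= 2 / (s * (s + 1)).
  move=> nij; have [Gij|nGij] := boolP (G i j).
    by rewrite paley_opt_adj // lexx.
  by rewrite paley_opt_nonadj // c0 lexx.
apply: STAB2_diag_dominant.
- by rewrite /submatrix trmx_mxsub paley_opt_sym.
- move=> i j; rewrite mxE; have [->|nij] := eqVneq i j.
    by rewrite paley_opt_diag invr_ge0; lra.
  have /offdiag/andP[] // : enum_val i != enum_val j.
  by rewrite (inj_eq enum_val_inj).
- by move=> i j Gij; rewrite mxE paley_opt_adj.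
- move=> i; rewrite mxE paley_opt_diag.
  apply: le_trans (_ : \sum_(j | j != i) 2 / (s * (s + 1)) <= _).
    apply: ler_sum => j nji; rewrite mxE.
    have /offdiag/andP[] // : enum_val i != enum_val j.
    by rewrite (inj_eq enum_val_inj) eq_sym.
  rewrite sumr_const cardC1 card_ord -[_ *+ _.-1]mulr_natr.
  (* The row index shows that I is nonempty, so the truncated predecessor is a true subtraction. *)
  have I0 : (0 < #|I|)%N by apply: leq_ltn_trans (ltn_ord i).
  rewrite -subn1 natrB //.
  rewrite -ler_pdivlMl ?divr_gt0 ?mulr_gt0 //; try lra.
  rewrite (_ : _^-1 * s^-1 = (s + 1) / 2).
    by rewrite lerBlDr (le_trans cardI) //; lra.
  by field; rewrite !gt_eqF //; lra.
- rewrite /mxtrace; under eq_bigr do rewrite mxE paley_opt_diag.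
  rewrite sumr_const card_ord -[s^-1 *+ _]mulr_natl ler_pdivrMr ?mul1r; last by lra.
  (* The trace condition is |I| <= s. Sizes up to 2 use s > 2; from size 3 on, the hypothesis gives
     s >= 3, hence (s+3)/2 <= s. *)
  have [I2|I3] := leqP #|I| 2; first by rewrite (le_trans _ (ltW s2)) ?ler_nat.
  have : (3 : R) <= #|I|%:R by rewrite ler_nat.
  by lra.
Qed.

(** Both suprema are maxima equal to s: the upper bound for theta also holds on the smaller region,
    and [paley_opt] attains it in both. *)
Lemma esh_paley (k : nat) : k%:R <= (s + 3) / 2 -> esh R k G = theta R G.
Proof.
move=> kP; have s2 := sqrt_order_gt2.
have optE : \sum_i (const_mx s^-1 : 'cV[R]_n) i 0 = s.
  under eq_bigr do rewrite mxE.
  rewrite sumr_const card_ord -[s^-1 *+ _]mulr_natr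
    -[X in _ * X]sqr_sqrt_order expr2 mulKf //.
  by rewrite gt_eqF //; lra.
have max_s (A : set R) : A s -> ubound A s -> sup A = s.
  move=> As ubA; apply/eqP; rewrite eq_le; apply/andP; split.
    by apply: sup_le_ub => //; exists s.
  by apply: ub_le_sup => //; exists s.
rewrite /esh /theta !max_s //.
- by exists paley_opt, (const_mx s^-1); rewrite optE; split=> //; exact: paley_opt_feasible.
- by move=> _ [X [x [FX ->]]]; exact: theta_feasible_le_sqrt FX.
- exists paley_opt, (const_mx s^-1); rewrite optE.
  split=> [|I cI|//]; first exact: paley_opt_feasible.
  by apply: paley_opt_STAB2; rewrite cI (le_trans _ kP) // ler_nat geq_minl.
- by move=> _ [X [x [FX _ ->]]]; exact: theta_feasible_le_sqrt FX.
Qed.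

End PaleyMatrices.

Theorem theorem14 (R : realType) (q : nat) (hq : prime_power q)
    (hq4 : q = 1 %[mod 4]) (F : finFieldType) (hF : #|F| = q)
    (k : nat) (hk : k%:R <= (Num.sqrt q%:R + 3) / 2 :> R) :
  esh R k (paley_graph hF hq4) = theta R (paley_graph hF hq4).
Proof. by apply: esh_paley; rewrite hF. Qed.
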